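(* Let $\mathbb{F}\subseteq\overline{\mathbb{F}}$ be any field extension and let $\ell,m\ge1$ be integers. Then $$\left(\big(\mathrm{Sym}^{\ell m}(\mathbb{F}^{\ell\times\ell\times2})\big)^{\mathrm{SL}_\ell(\overline{\mathbb{F}})\times\mathrm{SL}_\ell(\overline{\mathbb{F}})}\right)^\star_{\mathbb{F}}\ \cong\ \left(\mathrm{Sym}_{\ell m}(\mathbb{F}^{\ell\times\ell\times2})\right)_{\mathrm{SL}_\ell(\overline{\mathbb{F}})\times\mathrm{SL}_\ell(\overline{\mathbb{F}})}$$ as $\mathrm{SL}_2(\mathbb{F})$-representations.
   Context: The symbol $\overline{\mathbb{F}}$ denotes an arbitrary extension field of $\mathbb{F}$ here (the paper's main application is the algebraic closure). Write $\mathbb{F}^{\ell\times\ell\times 2}:=\mathbb{F}^\ell\otimes\mathbb{F}^\ell\otimes\mathbb{F}^2$, and similarly over $\overline{\mathbb{F}}$; spaces over $\mathbb{F}$ are regarded as subsets of their scalar extensions to $\overline{\mathbb{F}}$. Here $\mathrm{Sym}^d$ denotes the $d$-th symmetric power, $\mathrm{Sym}_d U=(\bigotimes^d U)^{\mathfrak{S}_d}$ the space of symmetric tensors, and $(\cdot)^\star_{\mathbb{F}}$ the $\mathbb{F}$-linear dual with contragredient action. The group $Z:=\mathrm{SL}_\ell(\overline{\mathbb{F}})\times\mathrm{SL}_\ell(\overline{\mathbb{F}})$ acts $\overline{\mathbb{F}}$-linearly on $\overline{\mathbb{F}}^{\ell\times\ell\times2}$ by $(g_1,g_2)(v_1\otimes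 v_2\otimes v_3)=g_1v_1\otimes g_2v_2\otimes v_3$, and $\mathrm{SL}_2(\mathbb{F})$ acts on $\mathbb{F}^{\ell\times\ell\times2}$ through the third tensor factor; these induce actions on $\mathrm{Sym}^d$ and $\mathrm{Sym}_d$. Invariants: $\big(\mathrm{Sym}^{d}(\mathbb{F}^{\ell\times\ell\times2})\big)^{Z}:=\big(\mathrm{Sym}^{d}(\overline{\mathbb{F}}^{\ell\times\ell\times2})\big)^{Z}\cap\mathrm{Sym}^{d}(\mathbb{F}^{\ell\times\ell\times2})$. Coinvariants: with $W=\mathrm{Sym}_{d}(\overline{\mathbb{F}}^{\ell\times\ell\times2})$ and $I=\langle zw-w\mid z\in Z,w\in W\rangle_{\overline{\mathbb{F}}}$, define $\big(\mathrm{Sym}_{d}(\mathbb{F}^{\ell\times\ell\times2})\big)_Z:=\{v+I\in W/I\mid v\in\mathrm{Sym}_{d}(\mathbb{F}^{\ell\times\ell\times2})\}$, an $\mathbb{F}$-subspace of $W/I$ with the induced $\mathrm{SL}_2(\mathbb{F})$-action. *)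

(* Defs.v *)
From HB Require Import structures.
From mathcomp Require Import all_boot all_fingroup all_algebra.
From mathcomp Require Import boolp functions.

Set Implicit Arguments.
Unset Strict Implicit.
Unset Printing Implicit Defensive.

Import GRing.Theory.
Local Open Scope ring_scope.
Local Open Scope quotient_scope.

(* fingroup also defines a repr. *)
Local Notation repr := generic_quotient.repr.

(* Subspaces and quotients of arbitrary (possibly infinite dimensional)      *)
(* vector spaces; membership in a subspace is made boolean classically.       *)

Section Subspace.
Variables (F : fieldType) (V : lmodType F) (S : submodClosed V).

Record subspace := Subspace { subspace_val : V; _ : subspace_val \in S }.

HB.instance Definition _ := [isSub for subspace_val].
HB.instance Definition _ := [Choice of subspace by <:].
HB.instance Definition _ := [SubChoice_isSubLmodule of subspace by <:].
End Subspace.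

Section QuotientSpace.
Variables (F : fieldType) (V : lmodType F) (S : submodClosed V).

Definition quot_pred : {pred V} := fun v => v \in S.

Fact quot_pred_submod_closed : submod_closed quot_pred.
Proof. exact: (submodClosedP S). Qed.

HB.instance Definition _ := GRing.isSubmodClosed.Build F V quot_pred
  quot_pred_submod_closed.

Definition quotspace := Quotient.quot quot_pred.

HB.instance Definition _ := GRing.Zmodule.on quotspace.
HB.instance Definition _ := Quotient.on quotspace.

Definition proj (v : V) : quotspace := \pi_(Quotient.quot quot_pred) v.

Lemma proj_eq u v : (proj u == proj v) = (u - v \in S).
Proof. by rewrite -[RHS]/(u - v \in quot_pred) Quotient.idealrBE. Qed.

Lemma proj_eqP u v : u - v \in S -> proj u = proj v.
Proof. by rewrite -proj_eq => /eqP. Qed.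

Lemma proj_repr x : proj (repr x) = x.
Proof. exact: reprK. Qed.

Lemma proj_reprB v : repr (proj v) - v \in S.
Proof. by rewrite -proj_eq proj_repr. Qed.

Lemma projD u v : proj (u + v) = proj u + proj v.
Proof. exact: (raddfD \pi_(Quotient.quot quot_pred)). Qed.

Definition quot_scale (a : F) (x : quotspace) : quotspace := proj (a *: repr x).

Lemma quot_scaleE a v : quot_scale a (proj v) = proj (a *: v).
Proof. by apply: proj_eqP; rewrite -scalerBr rpredZ // proj_reprB. Qed.

Fact quot_scaleA a b x :
  quot_scale a (quot_scale b x) = quot_scale (a * b) x.
Proof. by rewrite -(proj_repr x) !quot_scaleE scalerA. Qed.

Fact quot_scale1 : left_id 1 quot_scale.
Proof. by move=> x; rewrite -(proj_repr x) quot_scaleE scale1r. Qed.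

Fact quot_scaleDr : right_distributive quot_scale +%R.
Proof.
move=> a x y; rewrite -(proj_repr x) -(proj_repr y) -projD !quot_scaleE.
by rewrite scalerDr projD.
Qed.

Fact quot_scaleDl x : {morph quot_scale^~ x : a b / a + b}.
Proof.
by move=> a b; rewrite -(proj_repr x) !quot_scaleE scalerDl projD.
Qed.

HB.instance Definition _ := GRing.Zmodule_isLmodule.Build F quotspace
  quot_scaleA quot_scale1 quot_scaleDr quot_scaleDl.

Fact proj_is_linear : linear proj.
Proof. by move=> a u v; rewrite projD -quot_scaleE. Qed.

HB.instance Definition _ := GRing.isLinear.Build F V quotspace _ proj
  proj_is_linear.
End QuotientSpace.

Section Span.
Variables (F : fieldType) (V : lmodType F) (P : V -> Prop).

Definition linspan : {pred V} := fun v =>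
  `[< exists n (c : 'I_n -> F) (u : 'I_n -> V),
        (forall i, P (u i)) /\ v = \sum_i c i *: u i >].

Lemma linspanP v : P v -> v \in linspan.
Proof.
move=> Pv; apply/asboolP; exists 1%N, (fun=> 1), (fun=> v); split=> //.
by rewrite big_ord1 scale1r.
Qed.

Fact linspan_submod_closed : submod_closed linspan.
Proof.
split; first by apply/asboolP; exists 0%N, (fun=> 0), (fun=> 0);
  split=> [[]//|]; rewrite big_ord0.
move=> a v w /asboolP[n [c [u [Pu ->]]]] /asboolP[n' [c' [u' [Pu' ->]]]].
apply/asboolP; exists (n + n')%N.
exists (fun i =>
  match fintype.split i with inl j => a * c j | inr j => c' j end).
exists (fun i =>
  match fintype.split i with inl j => u j | inr j => u' j end).
split=> [i|]; first by case: fintype.split.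
rewrite big_split_ord /= scaler_sumr; congr (_ + _); apply: eq_bigr => i _.
  by rewrite (unsplitK (inl i)) scalerA.
by rewrite (unsplitK (inr i)).
Qed.

HB.instance Definition _ := GRing.isSubmodClosed.Build F V linspan
  linspan_submod_closed.
End Span.

Lemma linspan_stable (F : fieldType) (V W : lmodType F) (P : V -> Prop)
    (S : submodClosed W) (f : {linear V -> W}) :
  (forall v, P v -> f v \in S) -> forall v, v \in linspan P -> f v \in S.
Proof.
move=> fP _ /asboolP[n [c [u [Pu ->]]]]; rewrite linear_sum rpred_sum // => i _.
by rewrite linearZ rpredZ // fP.
Qed.

(* The F-space underlying a K-space; iota is a phantom parameter of restr so  *)
(* that the F-scaling can be inferred from the type.                          *)
Section RestrictScalars.
Variables (F K : fieldType) (iota : {rmorphism F -> K}) (M : lmodType K).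

Definition restr : Type := let _ := iota in M.

HB.instance Definition _ := GRing.Zmodule.copy restr M.

Definition restr_scale (a : F) (x : restr) : restr := iota a *: (x : M).

Fact restr_scaleA a b x :
  restr_scale a (restr_scale b x) = restr_scale (a * b) x.
Proof. by rewrite /restr_scale scalerA rmorphM. Qed.

Fact restr_scale1 : left_id 1 restr_scale.
Proof. by move=> x; rewrite /restr_scale rmorph1 scale1r. Qed.

Fact restr_scaleDr : right_distributive restr_scale +%R.
Proof. by move=> a x y; rewrite /restr_scale scalerDr. Qed.

Fact restr_scaleDl x : {morph restr_scale^~ x : a b / a + b}.
Proof. by move=> a b; rewrite /restr_scale rmorphD scalerDl. Qed.

HB.instance Definition _ := GRing.Zmodule_isLmodule.Build F restr
  restr_scaleA restr_scale1 restr_scaleDr restr_scaleDl.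
End RestrictScalars.

Record rep (F : fieldType) (G : groupType) := Rep {
  rep_space :> lmodType F;
  rep_act : G -> rep_space -> rep_space;
  rep_linear : forall g, linear (rep_act g);
  rep_act1 : forall v, rep_act 1%g v = v;
  rep_actM : forall g h v, rep_act (g * h)%g v = rep_act g (rep_act h v) }.

Definition rep_iso (F : fieldType) (G : groupType) (V W : rep F G) : Prop :=
  exists f : {linear V -> W},
    bijective f /\ forall g v, f (rep_act g v) = rep_act g (f v).

Section RepLinear.
Variables (F : fieldType) (G : groupType) (V : rep F G) (g : G).
HB.instance Definition _ := GRing.isLinear.Build F V V _ (rep_act g)
  (@rep_linear _ _ V g).
End RepLinear.

Section SubRep.
Variables (F : fieldType) (G : groupType) (V : rep F G) (S : submodClosed V).
Hypothesis stS : forall g v, v \in S -> rep_act g v \in S.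

Definition subrep_act (g : G) (x : subspace S) : subspace S :=
  Subspace (stS g (valP x)).

Fact subrep_linear g : linear (subrep_act g).
Proof. by move=> a x y; apply: val_inj; rewrite /= !linearP. Qed.

Fact subrep_act1 x : subrep_act 1%g x = x.
Proof. by apply: val_inj; rewrite /= rep_act1. Qed.

Fact subrep_actM g h x :
  subrep_act (g * h)%g x = subrep_act g (subrep_act h x).
Proof. by apply: val_inj; rewrite /= rep_actM. Qed.

Definition subrep : rep F G := Rep subrep_linear subrep_act1 subrep_actM.
End SubRep.

Section QuotRep.
Variables (F : fieldType) (G : groupType) (V : rep F G) (S : submodClosed V).
Hypothesis stS : forall g v, v \in S -> rep_act g v \in S.

Definition quotrep_act (g : G) (x : quotspace S) : quotspace S :=
  proj S (rep_act g (repr x)).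

Lemma quotrep_actE g v : quotrep_act g (proj S v) = proj S (rep_act g v).
Proof. by apply: proj_eqP; rewrite -linearB stS // proj_reprB. Qed.

Fact quotrep_linear g : linear (quotrep_act g).
Proof.
move=> a x y; rewrite -(proj_repr x) -(proj_repr y) -linearP !quotrep_actE.
by rewrite !linearP.
Qed.

Fact quotrep_act1 x : quotrep_act 1%g x = x.
Proof. by rewrite -(proj_repr x) quotrep_actE rep_act1. Qed.

Fact quotrep_actM g h x :
  quotrep_act (g * h)%g x = quotrep_act g (quotrep_act h x).
Proof. by rewrite -(proj_repr x) !quotrep_actE rep_actM. Qed.

Definition quotrep : rep F G := Rep quotrep_linear quotrep_act1 quotrep_actM.
End QuotRep.

Section DualRep.
Variables (F : fieldType) (G : groupType) (V : rep F G).

Definition is_form : {pred V -> F^o} := fun f => `[< linear f >].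

Fact is_form_submod_closed : submod_closed is_form.
Proof.
split=> [|a f g /asboolP lf /asboolP lg]; apply/asboolP => b u v.
  by rewrite scaler0 addr0.
rewrite !addrfctE !scalrfctE lf lg !scalerDr !scalerA mulrC -!addrA.
by congr (_ + _); rewrite addrCA.
Qed.

HB.instance Definition _ := GRing.isSubmodClosed.Build F (V -> F^o) is_form
  is_form_submod_closed.

Definition dual_space := subspace is_form.

HB.instance Definition _ := GRing.Lmodule.on dual_space.

Fact dual_act_subproof (g : G) (f : dual_space) :
  (fun v => val f (rep_act g^-1%g v)) \in is_form.
Proof.
by have /asboolP lf := valP f; apply/asboolP => a u v; rewrite linearP lf.
Qed.

Definition dual_act (g : G) (f : dual_space) : dual_space :=
  Subspace (dual_act_subproof g f).

Fact dual_linear g : linear (dual_act g).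
Proof. by move=> a f h; apply: val_inj. Qed.

Fact dual_act1 f : dual_act 1%g f = f.
Proof.
by apply: val_inj; apply/funext => v /=; rewrite invg1 rep_act1.
Qed.

Fact dual_actM g h f : dual_act (g * h)%g f = dual_act g (dual_act h f).
Proof.
by apply: val_inj; apply/funext => v /=; rewrite invMg rep_actM.
Qed.

Definition dualrep : rep F G := Rep dual_linear dual_act1 dual_actM.
End DualRep.

Section RestrictRep.
Variables (F K : fieldType) (iota : {rmorphism F -> K}) (H G : groupType).
Variables (phi : H -> G) (V : rep K G).
Hypotheses (phi1 : phi 1%g = 1%g) (phiM : {morph phi : x y / (x * y)%g}).

Definition resrep_act (h : H) (x : restr iota V) : restr iota V :=
  rep_act (phi h) (x : V).

Fact resrep_linear h : linear (resrep_act h).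
Proof. by move=> a x y; rewrite /resrep_act -linearP. Qed.

Fact resrep_act1 x : resrep_act 1%g x = x.
Proof. by rewrite /resrep_act phi1 rep_act1. Qed.

Fact resrep_actM g h x :
  resrep_act (g * h)%g x = resrep_act g (resrep_act h x).
Proof. by rewrite /resrep_act phiM rep_actM. Qed.

Definition resrep : rep F H := Rep resrep_linear resrep_act1 resrep_actM.
End RestrictRep.

Section SpecialLinear.
Variables (n : nat) (F : fieldType).

Record SL := MkSL { SLval :> 'M[F]_n; _ : \det SLval == 1 }.

HB.instance Definition _ := [isSub for SLval].
HB.instance Definition _ := [Choice of SL by <:].

Lemma det_SL (g : SL) : \det g = 1.
Proof. exact/eqP/(valP g). Qed.

Lemma unitmx_SL (g : SL) : (g : 'M_n) \in unitmx.
Proof. by rewrite unitmxE det_SL unitr1. Qed.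

Fact SL_one_subproof : \det (1%:M : 'M[F]_n) == 1.
Proof. by rewrite det1. Qed.
Fact SL_mul_subproof (g h : SL) : \det (g *m h) == 1.
Proof. by rewrite det_mulmx !det_SL mulr1. Qed.
Fact SL_inv_subproof (g : SL) : \det (invmx g) == 1.
Proof. by rewrite det_inv det_SL invr1. Qed.

Definition SL_one := MkSL SL_one_subproof.
Definition SL_mul g h := MkSL (SL_mul_subproof g h).
Definition SL_inv g := MkSL (SL_inv_subproof g).

Fact SL_mulA : associative SL_mul.
Proof. by move=> x y z; apply: val_inj; rewrite /= mulmxA. Qed.
Fact SL_mul1 : left_id SL_one SL_mul.
Proof. by move=> x; apply: val_inj; rewrite /= mul1mx. Qed.
Fact SL_mulr1 : right_id SL_one SL_mul.
Proof. by move=> x; apply: val_inj; rewrite /= mulmx1. Qed.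
Fact SL_mulV : left_inverse SL_one SL_inv SL_mul.
Proof. by move=> x; apply: val_inj; rewrite /= mulVmx ?unitmx_SL. Qed.
Fact SL_mulrV : right_inverse SL_one SL_inv SL_mul.
Proof. by move=> x; apply: val_inj; rewrite /= mulmxV ?unitmx_SL. Qed.

HB.instance Definition _ := isGroup.Build SL
  SL_mulA SL_mul1 SL_mulr1 SL_mulV SL_mulrV.
End SpecialLinear.

Section MapSL.
Variables (n : nat) (F K : fieldType) (iota : {rmorphism F -> K}).

Fact map_SL_subproof (g : SL n F) : \det (map_mx iota g) == 1.
Proof. by rewrite det_map_mx det_SL rmorph1. Qed.

Definition map_SL (g : SL n F) : SL n K := MkSL (map_SL_subproof g).

Lemma map_SL1 : map_SL 1%g = 1%g.
Proof. by apply: val_inj; rewrite /= map_mx1. Qed.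

Lemma map_SLM : {morph map_SL : g h / (g * h)%g}.
Proof. by move=> g h; apply: val_inj; rewrite /= map_mxM. Qed.
End MapSL.

(* Operators on the coordinate space {ffun I -> F^o}, given by their matrix   *)
(* A : I -> I -> F; the regular module F^o provides the vector space          *)
(* structure of this function space.                                          *)
Section Operators.
Variables (F : fieldType) (I : finType).
Implicit Types (A B : I -> I -> F) (v : {ffun I -> F^o}).

Definition opmx A v : {ffun I -> F^o} := [ffun i => \sum_j A i j * v j].

Fact opmx_is_linear A : linear (opmx A).
Proof.
move=> a u v; apply/ffunP => i; rewrite !ffunE scaler_sumr -big_split /=.
by apply: eq_bigr => j _; rewrite !ffunE mulrDr; congr (_ + _); rewrite mulrCA.
Qed.

HB.instance Definition _ A := GRing.isLinear.Build
  F {ffun I -> F^o} {ffun I -> F^o} _ (opmx A) (opmx_is_linear A).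

Lemma opmx1 A v : (forall i j, A i j = (i == j)%:R) -> opmx A v = v.
Proof.
move=> A1; apply/ffunP => i; rewrite ffunE (bigD1 i) //= A1 eqxx mul1r.
rewrite big1 ?addr0 // => j /negPf ji; by rewrite A1 eq_sym ji mul0r.
Qed.

Lemma opmxM A B C v : (forall i j, C i j = \sum_k A i k * B k j) ->
  opmx C v = opmx A (opmx B v).
Proof.
move=> CE; apply/ffunP => i; rewrite !ffunE.
under eq_bigr => j _ do rewrite CE mulr_suml.
rewrite exchange_big; apply: eq_bigr => k _; rewrite !ffunE mulr_sumr.
by apply: eq_bigr => j _; rewrite mulrA.
Qed.
End Operators.

(* For U = {ffun I -> F^o} with its standard basis e_i, the d-th tensor power *)
(* is {ffun {ffun 'I_d -> I} -> F^o}, whose basis vector with index w is      *)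
(* e_(w 0) (x) ... (x) e_(w d.-1).                                            *)
Section TensorPower.
Variables (F : fieldType) (I : finType) (d : nat).

Definition tpow := {ffun {ffun 'I_d -> I} -> F^o}.
HB.instance Definition _ := GRing.Lmodule.on tpow.

Implicit Types (A B : I -> I -> F) (t : tpow) (s : 'S_d).

Definition ptensor (u : 'I_d -> {ffun I -> F^o}) : tpow :=
  [ffun w : {ffun 'I_d -> I} => \prod_k u k (w k)].

Definition tpow_mx A (w w' : {ffun 'I_d -> I}) : F := \prod_k A (w k) (w' k).

Definition tpow_op A : tpow -> tpow := opmx (tpow_mx A).
HB.instance Definition _ A := GRing.Linear.on (tpow_op A).

Lemma tpow_op_ptensor A u : tpow_op A (ptensor u) = ptensor (opmx A \o u).
Proof.
apply/ffunP => w; rewrite !ffunE.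
under [RHS]eq_bigr => k _ do rewrite ffunE.
rewrite bigA_distr_bigA; apply: eq_bigr => w' _.
by rewrite ffunE -big_split.
Qed.

Lemma tpow_op1 A t : (forall i j, A i j = (i == j)%:R) -> tpow_op A t = t.
Proof.
move=> A1; apply: opmx1 => w w'; rewrite /tpow_mx.
have [->|/eqP ww'] := eqVneq; first by rewrite big1 // => k _; rewrite A1 eqxx.
have [k kP] : exists k, w k != w' k.
  apply/existsP; apply: contra_notT ww'; rewrite negb_exists => /forallP e.
  by apply/ffunP => k; apply/eqP; rewrite -[_ == _]negbK.
by rewrite (bigD1 k) //= A1 (negPf kP) mul0r.
Qed.

Lemma tpow_opM A B C t : (forall i j, C i j = \sum_k A i k * B k j) ->
  tpow_op C t = tpow_op A (tpow_op B t).
Proof.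
move=> CE; apply: opmxM => w w'; rewrite /tpow_mx.
under eq_bigr => k _ do rewrite CE.
by rewrite bigA_distr_bigA; apply: eq_bigr => w'' _; rewrite -big_split.
Qed.

Definition tpow_perm s t : tpow :=
  [ffun w : {ffun 'I_d -> I} => t [ffun k => w (s k)]].

Fact tpow_perm_is_linear s : linear (tpow_perm s).
Proof. by move=> a t t'; apply/ffunP => w; rewrite !ffunE. Qed.

HB.instance Definition _ s := GRing.isLinear.Build F tpow tpow _ (tpow_perm s)
  (tpow_perm_is_linear s).

Lemma tpow_perm_op s A t :
  tpow_perm s (tpow_op A t) = tpow_op A (tpow_perm s t).
Proof.
apply/ffunP => w; rewrite !ffunE.
pose h (w' : {ffun 'I_d -> I}) : {ffun 'I_d -> I} := [ffun k => w' (s k)].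
have hI : injective h.
  move=> w1 w2 /ffunP e; apply/ffunP => k.
  by have := e ((s^-1)%g k); rewrite !ffunE permKV.
rewrite (reindex_inj hI); apply: eq_bigr => w' _; rewrite ffunE; congr (_ * _).
rewrite /tpow_mx [RHS](reindex_inj (@perm_inj _ s)).
by apply: eq_bigr => k _; rewrite !ffunE.
Qed.

Definition is_symT : {pred tpow} := fun t => [forall s, tpow_perm s t == t].

Fact is_symT_submod_closed : submod_closed is_symT.
Proof.
split=> [|a t t' /forallP ht /forallP ht']; apply/forallP => s.
  by rewrite linear0.
by rewrite linearP /= (eqP (ht s)) (eqP (ht' s)).
Qed.

HB.instance Definition _ := GRing.isSubmodClosed.Build F tpow is_symT
  is_symT_submod_closed.

Definition is_sym_rel : {pred tpow} :=
  linspan (fun t => exists s t', t = tpow_perm s t' - t').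

HB.instance Definition _ := GRing.SubmodClosed.on is_sym_rel.

(* symT is Sym_d U, the subspace of symmetric tensors, and symP is Sym^d U,   *)
(* the quotient of the tensor power by all differences s t - t.               *)
Definition symT := subspace is_symT.
Definition symP := quotspace is_sym_rel.
HB.instance Definition _ := GRing.Lmodule.on symT.
HB.instance Definition _ := GRing.Lmodule.on symP.

Lemma tpow_op_symT A t : t \in is_symT -> tpow_op A t \in is_symT.
Proof.
move=> /forallP ht; apply/forallP => s.
by rewrite tpow_perm_op (eqP (ht s)).
Qed.

Lemma tpow_op_sym_rel A t : t \in is_sym_rel -> tpow_op A t \in is_sym_rel.
Proof.
apply: linspan_stable => {}t [s [t' ->]]; apply: linspanP.
by exists s, (tpow_op A t'); rewrite linearB tpow_perm_op.
Qed.

Definition symT_op A (x : symT) : symT := Subspace (tpow_op_symT A (valP x)).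

Definition symP_op A (x : symP) : symP :=
  proj is_sym_rel (tpow_op A (repr x)).

Lemma symP_opE A t :
  symP_op A (proj is_sym_rel t) = proj is_sym_rel (tpow_op A t).
Proof. by apply: proj_eqP; rewrite -linearB tpow_op_sym_rel // proj_reprB. Qed.

Fact symT_op_is_linear A : linear (symT_op A).
Proof. by move=> a x y; apply: val_inj; rewrite /= !linearP. Qed.

Fact symP_op_is_linear A : linear (symP_op A).
Proof.
move=> a x y; rewrite -(proj_repr x) -(proj_repr y) -linearP !symP_opE.
by rewrite !linearP.
Qed.

HB.instance Definition _ A := GRing.isLinear.Build F symT symT _ (symT_op A)
  (symT_op_is_linear A).
HB.instance Definition _ A := GRing.isLinear.Build F symP symP _ (symP_op A)
  (symP_op_is_linear A).

Lemma symT_op1 A x : (forall i j, A i j = (i == j)%:R) -> symT_op A x = x.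
Proof. by move=> A1; apply: val_inj; apply: tpow_op1. Qed.

Lemma symT_opM A B C x : (forall i j, C i j = \sum_k A i k * B k j) ->
  symT_op C x = symT_op A (symT_op B x).
Proof. by move=> CE; apply: val_inj; apply: tpow_opM. Qed.

Lemma symP_op1 A x : (forall i j, A i j = (i == j)%:R) -> symP_op A x = x.
Proof. by move=> A1; rewrite -(proj_repr x) symP_opE tpow_op1. Qed.

Lemma symP_opM A B C x : (forall i j, C i j = \sum_k A i k * B k j) ->
  symP_op C x = symP_op A (symP_op B x).
Proof.
by move=> CE; rewrite -(proj_repr x) !symP_opE; congr proj; apply: tpow_opM.
Qed.
End TensorPower.

(* tpow_ext, symT_ext and symP_ext realize the inclusions of the spaces over  *)
(* F in their scalar extensions along iota : F -> K.                          *)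
Section ScalarExtension.
Variables (F K : fieldType) (iota : {rmorphism F -> K}) (I : finType) (d : nat).

Definition tpow_ext (t : tpow F I d) : tpow K I d :=
  [ffun w : {ffun 'I_d -> I} => iota (t w)].

Fact tpow_extP a t t' :
  tpow_ext (a *: t + t') = iota a *: tpow_ext t + tpow_ext t'.
Proof. by apply/ffunP => w; rewrite !ffunE rmorphD rmorphM. Qed.

Lemma tpow_ext0 : tpow_ext 0 = 0.
Proof. by apply/ffunP => w; rewrite !ffunE rmorph0. Qed.

Lemma tpow_extB t t' : tpow_ext (t - t') = tpow_ext t - tpow_ext t'.
Proof. by apply/ffunP => w; rewrite !ffunE rmorphB. Qed.

Lemma tpow_ext_perm s t : tpow_ext (tpow_perm s t) = tpow_perm s (tpow_ext t).
Proof. by apply/ffunP => w; rewrite !ffunE. Qed.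

Lemma tpow_ext_op A B t : (forall i j, B i j = iota (A i j)) ->
  tpow_ext (tpow_op A t) = tpow_op B (tpow_ext t).
Proof.
move=> BE; apply/ffunP => w; rewrite !ffunE rmorph_sum.
apply: eq_bigr => w' _; rewrite rmorphM ffunE; congr (_ * _).
by rewrite rmorph_prod; apply: eq_bigr => k _; rewrite BE.
Qed.

Fact symT_ext_subproof (x : symT F I d) : tpow_ext (val x) \in @is_symT K I d.
Proof.
apply/forallP => s; have /forallP/(_ s)/eqP xP := valP x.
by rewrite -tpow_ext_perm xP.
Qed.

Definition symT_ext (x : symT F I d) : symT K I d :=
  Subspace (symT_ext_subproof x).

Definition symP_ext (x : symP F I d) : symP K I d :=
  proj (@is_sym_rel K I d) (tpow_ext (repr x)).

Lemma symP_extE t :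
  symP_ext (proj (@is_sym_rel F I d) t) =
  proj (@is_sym_rel K I d) (tpow_ext t).
Proof.
apply: proj_eqP; rewrite -tpow_extB.
have /asboolP[n [c [u [Pu ->]]]] :=
  proj_reprB (@is_sym_rel F I d) t.
elim/big_rec: _ => [|i y _ yP]; first by rewrite tpow_ext0 rpred0.
rewrite tpow_extP rpredD // rpredZ //; have [s [t' ->]] := Pu i.
by rewrite tpow_extB tpow_ext_perm; apply: linspanP; exists s, (tpow_ext t').
Qed.

Lemma symT_extP a x y :
  symT_ext (a *: x + y) = iota a *: symT_ext x + symT_ext y.
Proof. by apply: val_inj; apply: tpow_extP. Qed.

Lemma symP_extP a x y :
  symP_ext (a *: x + y) = iota a *: symP_ext x + symP_ext y.
Proof.
rewrite -(proj_repr x) -(proj_repr y) -linearP !symP_extE.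
by rewrite tpow_extP linearP.
Qed.

Lemma symT_ext_op A B x : (forall i j, B i j = iota (A i j)) ->
  symT_ext (symT_op A x) = symT_op B (symT_ext x).
Proof. by move=> BE; apply: val_inj; apply: tpow_ext_op. Qed.

Lemma symP_ext_op A B x : (forall i j, B i j = iota (A i j)) ->
  symP_ext (symP_op A x) = symP_op B (symP_ext x).
Proof.
move=> BE; rewrite -(proj_repr x) symP_opE !symP_extE symP_opE.
by congr proj; apply: tpow_ext_op.
Qed.
End ScalarExtension.

(* F^l (x) F^l (x) F^2 is {ffun idx l -> F^o}.                                *)
Definition idx (l : nat) : finType := ('I_l * 'I_l * 'I_2)%type.

Section TripleTensor.
Variables (F : fieldType) (l : nat).

Definition ptensor3 (u v : {ffun 'I_l -> F^o}) (w : {ffun 'I_2 -> F^o}) :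
  {ffun idx l -> F^o} := [ffun p : idx l => u p.1.1 * v p.1.2 * w p.2].

(* The matrix of A (x) B (x) C. *)
Definition mx3 (A B : 'M[F]_l) (C : 'M[F]_2) (p q : idx l) : F :=
  A p.1.1 q.1.1 * B p.1.2 q.1.2 * C p.2 q.2.

Lemma sum_idx (f g : 'I_l -> F) (h : 'I_2 -> F) :
  \sum_(p : idx l) f p.1.1 * g p.1.2 * h p.2 =
  (\sum_i f i) * (\sum_j g j) * (\sum_k h k).
Proof.
rewrite big_distrlr /= pair_big_dep /= big_distrlr /= pair_big_dep /=.
by apply: eq_bigr => -[[i j] k].
Qed.

Lemma mx3_ptensor3 A B C u v w :
  opmx (mx3 A B C) (ptensor3 u v w) =
  ptensor3 (opmx (fun i j => A i j) u) (opmx (fun i j => B i j) v)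
           (opmx (fun i j => C i j) w).
Proof.
apply/ffunP => p; rewrite !ffunE -sum_idx; apply: eq_bigr => q _.
by rewrite ffunE /mx3 mulrACA [X in X * _]mulrACA.
Qed.

Lemma mx3_1 p q : mx3 1%:M 1%:M 1%:M p q = (p == q)%:R.
Proof.
rewrite /mx3 !mxE -!natrM !mulnb; case: p q => [[i j] k] [[i' j'] k'] /=.
by rewrite -!pair_eqE.
Qed.

Lemma mx3_M A B C A' B' C' p q :
  mx3 (A *m A') (B *m B') (C *m C') p q =
  \sum_r mx3 A B C p r * mx3 A' B' C' r q.
Proof.
rewrite /mx3 !mxE -sum_idx; apply: eq_bigr => r _.
by rewrite [RHS]mulrACA [X in _ = X * _]mulrACA.
Qed.
End TripleTensor.

Lemma mx3_map (F K : fieldType) (iota : {rmorphism F -> K}) l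
    (A B : 'M[F]_l) C p q :
  mx3 (map_mx iota A) (map_mx iota B) (map_mx iota C) p q =
  iota (mx3 A B C p q).
Proof. by rewrite /mx3 !mxE !rmorphM. Qed.

Definition Zgroup (l : nat) (F : fieldType) := (SL l F * SL l F)%type.

Section Actions.
Variables (F : fieldType) (l d : nat).

Definition Zmx (z : Zgroup l F) := mx3 z.1 z.2 1%:M.
Definition SL2mx (g : SL 2 F) := @mx3 F l 1%:M 1%:M g.

Lemma SL2mx1 i j : SL2mx 1%g i j = (i == j)%:R.
Proof. exact: mx3_1. Qed.

Lemma SL2mxM g h i j :
  SL2mx (g * h)%g i j = \sum_k SL2mx g i k * SL2mx h k j.
Proof. by rewrite -mx3_M !mulmx1. Qed.

Lemma SL2_ZmxC z g i j :
  \sum_k SL2mx g i k * Zmx z k j = \sum_k Zmx z i k * SL2mx g k j.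
Proof. by rewrite -!mx3_M !mulmx1 !mul1mx. Qed.

Lemma symT_SL2_Z z g (x : symT F (idx l) d) :
  symT_op (SL2mx g) (symT_op (Zmx z) x) = symT_op (Zmx z) (symT_op (SL2mx g) x).
Proof.
rewrite -!(symT_opM (C := fun i j => \sum_k Zmx z i k * SL2mx g k j)) //.
by move=> i j; rewrite SL2_ZmxC.
Qed.

Lemma symP_SL2_Z z g (x : symP F (idx l) d) :
  symP_op (SL2mx g) (symP_op (Zmx z) x) = symP_op (Zmx z) (symP_op (SL2mx g) x).
Proof.
rewrite -!(symP_opM (C := fun i j => \sum_k Zmx z i k * SL2mx g k j)) //.
by move=> i j; rewrite SL2_ZmxC.
Qed.

(* Sym^d and Sym_d of F^l (x) F^l (x) F^2, as representations of SL_2(F).     *)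
Definition symPrep : rep F (SL 2 F) :=
  @Rep F (SL 2 F) (symP F (idx l) d) (fun g => symP_op (SL2mx g))
    (fun g => symP_op_is_linear (SL2mx g))
    (fun x => symP_op1 x SL2mx1)
    (fun g h x => symP_opM x (SL2mxM g h)).

Definition symTrep : rep F (SL 2 F) :=
  @Rep F (SL 2 F) (symT F (idx l) d) (fun g => symT_op (SL2mx g))
    (fun g => symT_op_is_linear (SL2mx g))
    (fun x => symT_op1 x SL2mx1)
    (fun g h x => symT_opM x (SL2mxM g h)).

(* With W = Sym_d(F^l (x) F^l (x) F^2), coinv_rel is the span I of all        *)
(* z w - w and full_coinv is W / I.                                           *)
Definition coinv_rel : {pred symTrep} :=
  linspan (fun x : symTrep => exists (z : Zgroup l F) (w : symT F (idx l) d),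
    x = symT_op (Zmx z) w - w).

HB.instance Definition _ := GRing.SubmodClosed.on coinv_rel.

Lemma coinv_rel_stable g x : x \in coinv_rel -> rep_act g x \in coinv_rel.
Proof.
apply: linspan_stable => {}x [z [w ->]]; apply: linspanP.
by exists z, (symT_op (SL2mx g) w); rewrite linearB /= symT_SL2_Z.
Qed.

Definition full_coinv : rep F (SL 2 F) := quotrep coinv_rel_stable.
End Actions.

Section MainObjects.
Variables (F K : fieldType) (iota : {rmorphism F -> K}) (l d : nat).

Lemma SL2mx_map g i j :
  SL2mx (map_SL iota g) i j = iota (@SL2mx F l g i j).
Proof. by rewrite -mx3_map !map_mx1. Qed.

(* (Sym^d(F^{l x l x 2}))^Z, for Z = SL_l(K) x SL_l(K).                       *)
Definition is_inv : {pred symPrep F l d} := fun x =>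
  `[< forall z : Zgroup l K,
        symP_op (Zmx z) (symP_ext iota x) = symP_ext iota x >].

Fact is_inv_submod_closed : submod_closed is_inv.
Proof.
split=> [|a x y /asboolP xP /asboolP yP]; apply/asboolP => z.
  have -> : symP_ext iota (0 : symP F (idx l) d) = 0; last by rewrite linear0.
  by rewrite -(linear0 (proj _)) symP_extE tpow_ext0 linear0.
by rewrite symP_extP linearP /= xP yP.
Qed.

HB.instance Definition _ := GRing.isSubmodClosed.Build F (symPrep F l d) is_inv
  is_inv_submod_closed.

Lemma is_inv_stable (g : SL 2 F) x : x \in is_inv -> rep_act g x \in is_inv.
Proof.
move=> /asboolP xP; apply/asboolP => z.
by rewrite (symP_ext_op _ (SL2mx_map g)) -symP_SL2_Z xP.
Qed.

Definition invariants : rep F (SL 2 F) := subrep is_inv_stable.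

(* W / I, with scalars restricted to F and the action to SL_2(F).             *)
Definition coinv_ambient : rep F (SL 2 F) :=
  resrep iota (full_coinv K l d) (map_SL1 2 iota) (@map_SLM 2 F K iota).

(* (Sym_d(F^{l x l x 2}))_Z = {v + I | v in Sym_d(F^{l x l x 2})}.            *)
Definition is_coinv : {pred coinv_ambient} := fun x =>
  `[< exists v : symT F (idx l) d,
        x = proj (@coinv_rel K l d) (symT_ext iota v) >].

Fact is_coinv_submod_closed : submod_closed is_coinv.
Proof.
split=> [|a _ _ /asboolP[v ->] /asboolP[w ->]]; apply/asboolP.
  exists 0; have -> : symT_ext iota (0 : symT F (idx l) d) = 0.
    by apply: val_inj; rewrite /= tpow_ext0.
  by rewrite linear0.
by exists (a *: v + w); rewrite symT_extP linearP.
Qed.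

HB.instance Definition _ := GRing.isSubmodClosed.Build F coinv_ambient is_coinv
  is_coinv_submod_closed.

Lemma is_coinv_stable (g : SL 2 F) x :
  x \in is_coinv -> rep_act g x \in is_coinv.
Proof.
move=> /asboolP[v ->]; apply/asboolP; exists (symT_op (SL2mx g) v).
rewrite (symT_ext_op _ (SL2mx_map g)).
exact: (quotrep_actE (@coinv_rel_stable K l d) (map_SL iota g)).
Qed.

Definition coinvariants : rep F (SL 2 F) := subrep is_coinv_stable.
End MainObjects.

(* Main.v *)
(* The pairing <t, x> = sum_w t_w x_w on the tensor power identifies Sym_d    *)
(* with the dual of Sym^d, the matrix A on one side being adjoint to A^T on   *)
(* the other. As Z is stable under transposition, x is Z-invariant iff it is  *)
(* orthogonal to the span I of all z w - w. The theorem over F then amounts   *)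
(* to I being spanned over K by its F-rational vectors. To see this, generate *)
(* SL_l(K) by elementary matrices 1 + a E_ij: on an F-rational w, the vector  *)
(* z w - w is a polynomial in a with F-rational coefficients, and these       *)
(* coefficients lie in I if K has enough elements, while a finite K is        *)
(* handled by reducing exponents with a^|K| = a. Finally g acts on the dual   *)
(* through g^-T, which the Weyl element of SL_2 conjugates to g.              *)

From HB Require Import structures.
Require Import Defs.
From mathcomp Require Import all_boot all_fingroup all_algebra.
From mathcomp Require Import boolp functions.
From mathcomp Require Import generic_quotient.

Set Implicit Arguments.
Unset Strict Implicit.
Unset Printing Implicit Defensive.

Import GRing.Theory.
Local Open Scope ring_scope.

(** * Elementary generation of SL *)

Section SpecialLinearInduction.
Variable K : fieldType.

(** Under the dot product, [is_symT] and [is_sym_rel] are each other's annihilator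
    ([symT_annihilator], [sym_rel_annihilator]), and z is adjoint to its transpose. Hence the
    invariants over F are the classes of the F-tensors orthogonal to the K-space I
    ([inv_annihilator]), and every form on them is the pairing with a symmetric F-tensor v
    ([dual_representative]). It remains to see that v gives the zero form exactly when its class in
    W / I vanishes ([coinv_annihilator]).

    Over a single field this is biduality. Here forms are tested over F while I lives over K, and
    [coinv_tpow_rational] closes the gap: I is spanned over K by its F-rational vectors. That rests
    on [SL_elem_ind] and [poly_values_rat]. Sending the form of v to the class of v turns the action
    of g into that of g^-T; composing with the Weyl element repairs this ([weyl_tr]). *)

Definition elem_mx n (i j : 'I_n) (a : K) : 'M[K]_n :=
  1%:M + a *: delta_mx i j.

Lemma elem_mxE n (i j : 'I_n) (a : K) (A : 'M[K]_n) k l :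
  (elem_mx i j a *m A) k l = A k l + a * (k == i)%:R * A j l.
Proof.
rewrite mulmxDl mul1mx -scalemxAl !mxE (bigD1 j) //= !mxE eqxx andbT -mulrA.
by rewrite big1 ?addr0 // => p /negPf pj; rewrite !mxE pj andbF mul0r.
Qed.

Lemma elem_mxK n (i j : 'I_n) (a : K) (A : 'M[K]_n) :
  i != j -> elem_mx i j (- a) *m (elem_mx i j a *m A) = A.
Proof.
move=> /negPf ij; apply/matrixP => k l; rewrite !elem_mxE.
by rewrite (eq_sym j) ij mulr0 mul0r addr0 !mulNr addrK.
Qed.

(** Multilinearity in row [i]: the second summand [C] is the identity with row [i] replaced by row
    [j], so it has two equal rows. *)
Lemma det_elem_mx n (i j : 'I_n) (a : K) :
  i != j -> \det (elem_mx i j a) = 1.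
Proof.
move=> ij; pose C : 'M[K]_n := \matrix_(k, l) (l == if k == i then j else k)%:R.
rewrite (@determinant_multilinear _ _ _ 1%:M C i 1 a).
- rewrite det1 (@determinant_alternate _ _ C i j) ?mulr0 ?mulr1 ?addr0 // => k.
  by rewrite !mxE eqxx (eq_sym j) (negPf ij).
- by apply/rowP => k; rewrite !mxE eqxx mul1r [k == j]eq_sym.
- by apply/matrixP => k l;
  rewrite !mxE [lift i k == i]eq_sym (negPf (neq_lift _ _)) mulr0 addr0.
- apply/matrixP => k l; rewrite !mxE [lift i k == i]eq_sym.
  by rewrite (negPf (neq_lift _ _)) mulr0 addr0 eq_sym.
Qed.

(** Gaussian elimination, by induction on the size: row operations make the corner entry 1, and
    block elimination leaves a smaller block of determinant 1. *)
Lemma SL_elem_ind n (P : 'M[K]_n -> Prop) :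
  P 1%:M -> (forall A B, P A -> P B -> P (A *m B)) ->
  (forall i j a, i != j -> P (elem_mx i j a)) ->
  forall A, \det A = 1 -> P A.
Proof.
have elem_mx_block k (i j : 'I_(1 + k)) a : elem_mx i j a =
    col_mx (row_mx 1%:M 0) (row_mx 0 1%:M) + a *: delta_mx i j.
  by rewrite /elem_mx scalar_mx_block.
elim: n P => [|n IHn] P P1 PM PE; first by move=> A _;
  rewrite [A]thinmx0 -(thinmx0 1%:M).
(* Adding row blocks multiplies the unipotent matrices, so a block with a single nonzero entry
   suffices. *)
have PU (r : 'M[K]_(1, n)) : P (block_mx 1%:M r 0 1%:M : 'M_(1 + n)).
  rewrite (matrix_sum_delta r) big_ord1.
  apply: (big_ind (fun r => P (block_mx 1%:M r 0 1%:M : 'M_(1 + n)))) =>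
    [|r1 r2 P1' P2'|j _].
  - by rewrite -scalar_mx_block.
  - have -> : block_mx 1%:M (r1 + r2) 0 1%:M =
    block_mx 1%:M r2 0 1%:M *m block_mx 1%:M r1 0 1%:M :> 'M_(1 + n).
      by rewrite mulmx_block !mulmx1 !mul1mx !mul0mx !mulmx0 !addr0 !add0r.
    exact: PM.
  - have -> : block_mx 1%:M (r 0 j *: delta_mx 0 j) 0 1%:M =
              elem_mx (lshift n 0) (rshift 1 j) (r 0 j) :> 'M_(1 + n).
      rewrite elem_mx_block delta_mx_ushift delta_mx_rshift -(row_mx0 _ n 1 n).
      by rewrite scale_col_mx !scale_row_mx !scaler0 add_col_mx !add_row_mx
        !addr0 add0r.
    exact: PE.
have PL (c : 'M[K]_(n, 1)) : P (block_mx 1%:M 0 c 1%:M : 'M_(1 + n)).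
  rewrite (matrix_sum_delta c).
  apply: (big_ind (fun c => P (block_mx 1%:M 0 c 1%:M : 'M_(1 + n)))) =>
    [|c1 c2 P1' P2'|i _].
  - by rewrite -scalar_mx_block.
  - have -> : block_mx 1%:M 0 (c1 + c2) 1%:M =
    block_mx 1%:M 0 c1 1%:M *m block_mx 1%:M 0 c2 1%:M :> 'M_(1 + n).
      by rewrite mulmx_block !mulmx1 !mul1mx !mul0mx !mulmx0 !addr0 !add0r.
    exact: PM.
  - rewrite big_ord1.
    have -> : block_mx 1%:M 0 (c i 0 *: delta_mx i 0) 1%:M =
              elem_mx (rshift 1 i) (lshift n 0) (c i 0) :> 'M_(1 + n).
      rewrite elem_mx_block delta_mx_dshift delta_mx_lshift -(row_mx0 _ 1 1 n).
      by rewrite scale_col_mx !scale_row_mx !scaler0 add_col_mx !add_row_mx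
        !addr0 add0r.
    exact: PE.
have PD (B : 'M[K]_n) : \det B = 1 -> P (block_mx 1%:M 0 0 B : 'M_(1 + n)).
  apply: (IHn (fun B => P (block_mx 1%:M 0 0 B : 'M_(1 + n)))) =>
    [|A1 B1 PA PB|i j a ij].
  - by rewrite -scalar_mx_block.
  - have -> : block_mx 1%:M 0 0 (A1 *m B1) =
    block_mx 1%:M 0 0 A1 *m block_mx 1%:M 0 0 B1 :> 'M_(1 + n).
      by rewrite mulmx_block !mulmx1 !mul1mx !mul0mx !mulmx0 !addr0 !add0r.
    exact: PM.
  - have -> : block_mx 1%:M 0 0 (elem_mx i j a) =
              elem_mx (rshift 1 i) (rshift 1 j) a :> 'M_(1 + n).
      rewrite elem_mx_block delta_mx_dshift delta_mx_rshift -(row_mx0 _ 1 1 n).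
      by rewrite scale_col_mx !scale_row_mx !scaler0 add_col_mx !add_row_mx
        !addr0.
    by apply: PE; apply: contra_neq ij; exact: (@rshift_inj 1 n i j).
(* With corner 1, [A] is lower unipotent times block diagonal times upper unipotent; the Schur
   complement in the middle has determinant 1. *)
have P00 (A : 'M[K]_(1 + n)) : \det A = 1 -> A 0 0 = 1 -> P A.
  move=> A1 A00; pose r := ursubmx A; pose c := dlsubmx A.
  have AE : A = block_mx 1%:M 0 c 1%:M *m
     (block_mx 1%:M 0 0 (drsubmx A - c *m r) *m block_mx 1%:M r 0 1%:M).
    rewrite !mulmx_block !mulmx1 !mul1mx !mul0mx !mulmx0 !addr0 !add0r.
    rewrite addrC subrK mulmx1 -[LHS]submxK; congr block_mx.
    apply/matrixP => i j; rewrite !ord1 !mxE -[in RHS]A00.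
    by congr (A _ _); apply: val_inj.
  have := A1; rewrite {1}AE !det_mulmx !det_lblock det_ublock !det1 !mul1r
    !mulr1 => dB.
  by rewrite AE; do 2?apply: (PM) => //; apply: PD.
(* Adding [(1 - A 0 0) / A i 0] times row [i] to row 0 makes the corner 1. *)
have Pi0 (A : 'M[K]_(1 + n)) i : \det A = 1 -> i != 0 -> A i 0 != 0 -> P A.
  move=> A1 i0 Ai0; have e : (0 : 'I_(1 + n)) != i by rewrite eq_sym.
  rewrite -(elem_mxK ((1 - A 0 0) / A i 0) A e); apply: (PM); first exact: PE.
  apply: P00; first by rewrite det_mulmx det_elem_mx // mul1r.
  by rewrite elem_mxE eqxx mulr1 divfK // addrC subrK.
move=> A A1.
have [[i /andP[i0 Ai0]]|Ai0] := pselect (exists i, (i != 0) && (A i 0 != 0)).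
  exact: (Pi0 _ i).
have A00 : A 0 0 != 0.
  apply: contra_eq_neq A1 => A00;
    rewrite (expand_det_col _ 0) big1 1?eq_sym ?oner_eq0 //.
  move=> i _; have [->|i0] := eqVneq i 0; first by rewrite A00 mul0r.
  have [->|Ai] := eqVneq (A i 0) 0; first by rewrite mul0r.
  by case: Ai0; exists i; rewrite i0.
(* Only the corner of column 0 is nonzero. In size 1 it equals the determinant; otherwise adding row
   0 to row 1 leads back to [Pi0]. *)
case: n => [|n] in IHn P P1 PM PE PU PL PD P00 Pi0 A A1 Ai0 A00 *.
  by apply: P00 => //; rewrite -A1 det_mx11.
have e : lift ord0 ord0 != 0 :> 'I_(1 + n.+1) by [].
rewrite -(elem_mxK 1 A e); apply: (PM); first exact: PE.
apply: (Pi0 _ (lift ord0 ord0)) => //;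
  first by rewrite det_mulmx det_elem_mx // mul1r.
rewrite elem_mxE eqxx !mul1r.
have [->|Ai] := eqVneq (A (lift ord0 ord0) 0) 0; first by rewrite add0r.
by case: Ai0; exists (lift ord0 ord0); rewrite Ai.
Qed.
End SpecialLinearInduction.

(** * Duality for coordinate spaces *)

(** A free family of maximal length inside [S] spans it. This makes the projection [projv] available
    for [S]. *)
Lemma submod_vspace (F : fieldType) (vT : vectType F) (S : submodClosed vT) :
  exists U : {vspace vT}, forall v, (v \in U) = (v \in S).
Proof.
pose has_free k := `[< exists X : k.-tuple vT, free X /\ {subset X <= S} >].
have h0 : exists k, has_free k.
  by exists 0%N; apply/asboolP; exists [tuple]; rewrite nil_free.
have hb k : has_free k -> (k <= \dim {:vT})%N.
  case/asboolP=> X [fX _]; rewrite -(size_tuple X).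
  move: fX => /eqP <-; exact: dimvS (subvf _).
case: (ex_maxnP h0 hb) => k /asboolP[X [fX XS]] kmax.
exists <<X>>%VS => v; apply/idP/idP => [vX|vS].
  rewrite (coord_span vX) rpred_sum // => i _; rewrite rpredZ // XS //.
  by rewrite mem_nth ?size_tuple.
apply: contraT => vX; have := kmax k.+1; rewrite ltnn; apply.
apply/asboolP; exists [tuple of v :: X]; split; first by rewrite free_cons vX.
by move=> u; rewrite inE => /predU1P[->|/XS].
Qed.

Section DotProduct.
Variables (F : fieldType) (J : finType).
Implicit Types (t x y : {ffun J -> F^o}) (S : submodClosed {ffun J -> F^o}).

Definition dot t x : F^o := \sum_w t w * x w.

Lemma dotC t x : dot t x = dot x t.
Proof. by apply: eq_bigr => w _; rewrite mulrC. Qed.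

Lemma dot_is_linear t : linear (dot t).
Proof.
move=> a x y; rewrite /dot scaler_sumr -big_split; apply: eq_bigr => w _.
by rewrite !ffunE mulrDr; congr (_ + _); rewrite mulrCA.
Qed.

HB.instance Definition _ t := GRing.isLinear.Build F {ffun J -> F^o} F^o _
  (dot t) (dot_is_linear t).

Lemma dot_opmx A t x : dot (opmx A t) x = dot t (opmx (fun i j => A j i) x).
Proof.
rewrite /dot; under eq_bigr do rewrite ffunE mulr_suml.
rewrite exchange_big; apply: eq_bigr => j _; rewrite ffunE mulr_sumr.
by apply: eq_bigr => i _; rewrite mulrAC mulrC.
Qed.

Definition basis_ffun (w : J) : {ffun J -> F^o} := [ffun w' => (w' == w)%:R].

Lemma ffun_basisE x : x = \sum_w x w *: basis_ffun w.
Proof.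
apply/ffunP => w; rewrite sum_ffunE (bigD1 w) //= !ffunE eqxx big1 ?addr0.
  by rewrite [RHS]mulr1.
by move=> i iw; rewrite !ffunE eq_sym (negPf iw) [LHS]mulr0.
Qed.

Lemma dot_basis t w : dot t (basis_ffun w) = t w.
Proof.
rewrite /dot (bigD1 w) //= ffunE eqxx mulr1 big1 ?addr0 // => i /negPf iw.
by rewrite ffunE iw mulr0.
Qed.

Lemma form_dot (f : {ffun J -> F^o} -> F^o) :
  linear f -> exists t, forall x, f x = dot t x.
Proof.
move=> lf; exists [ffun w => f (basis_ffun w)] => x.
pose g : {linear {ffun J -> F^o} ->
  F^o} := HB.pack f (GRing.isLinear.Build _ _ _ _ f lf).
rewrite -[f]/(g : _ -> _) [x in LHS]ffun_basisE linear_sum;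
  apply: eq_bigr => w _.
by rewrite linearZ ffunE mulrC.
Qed.

(** As [f] is linear only on [S], it is first composed with a projection onto [S]. *)
Lemma extend_form S (f : {ffun J -> F^o} -> F^o) :
  (forall a x y, x \in S -> y \in S -> f (a *: x + y) = a *: f x + f y) ->
  exists t, {in S, forall x, f x = dot t x}.
Proof.
move=> lf; have [U US] := submod_vspace S.
have [|t tP] := @form_dot (fun x => f (projv U x)).
  by move=> a x y; rewrite linearP lf -?US ?memv_proj.
by exists t => x xS; rewrite -tP projv_id // US.
Qed.

(** The coordinates of [x - projv U x] are forms in [x] that vanish on [S]. *)
Lemma double_annihilator S x :
  (forall t, {in S, forall y, dot t y = 0} -> dot t x = 0) -> x \in S.
Proof.
have [U US] := submod_vspace S => xP; rewrite -US.
suff -> : x = projv U x by exact: memv_proj.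
apply/eqP; rewrite -subr_eq0; apply/eqP/ffunP => w.
have [|t tP] := @form_dot (fun y => (y - projv U y) w).
  move=> a y z; rewrite linearP !ffunE /= scalerBr opprD addrACA.
  by congr (_ + _).
rewrite tP xP ?ffunE // => y yS; rewrite -tP projv_id ?US // subrr ffunE //.
Qed.
End DotProduct.

Section Orthogonal.
Variables (F : fieldType) (J : finType) (x : {ffun J -> F^o}).

Definition dot_orth : {pred {ffun J -> F^o}} := fun n => dot n x == 0.

Fact dot_orth_submod_closed : submod_closed dot_orth.
Proof.
split=> [|a u v /eqP ux /eqP vx]; apply/eqP; rewrite dotC ?linear0 //.
by rewrite linearP /= ![dot x _]dotC ux vx scaler0 addr0.
Qed.

HB.instance Definition _ := GRing.isSubmodClosed.Build F {ffun J -> F^o}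
  dot_orth dot_orth_submod_closed.
End Orthogonal.

(** * Rational spans of polynomial families *)

(** Multiplication by a nonzero [a] permutes the nonzero elements; comparing their products gives
    the claim. *)
Lemma expf_size_enum (K : fieldType) (s : seq K) (a : K) :
  uniq s -> (forall x, x \in s) -> a ^+ size s = a.
Proof.
move=> us sK; have [->|a0] := eqVneq a 0.
  by have := sK 0; case: (s) => // x s' _; rewrite expr0n.
pose s' := rem 0 s; have us' : uniq s' by exact: rem_uniq.
have s'E x : (x \in s') = (x != 0) by rewrite mem_rem_uniq // !inE sK andbT.
have ss' : size s = (size s').+1.
  by rewrite size_rem ?sK // prednK //; have := sK 0; case: (s).
have /(perm_big _)/= e : perm_eq [seq a * x | x <- s'] s'.
  apply: uniq_perm => // [|x]; first by rewrite map_inj_uniq //; exact: mulfI.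
  rewrite s'E; apply/mapP/idP => [[y ys ->]|x0].
    by rewrite mulf_neq0 // -s'E.
  by exists (a^-1 * x); rewrite ?mulVKf // s'E mulf_neq0 ?invr_eq0.
have := e _ *%R 1 predT id;
  rewrite big_map big_split /= big_const_seq iter_mulr_1.
rewrite count_predT => /(congr1 (fun x => x / \prod_(x <- s') x)).
have p0 : \prod_(x <- s') x != 0 by rewrite prodf_seq_neq0; apply/allP => x;
  rewrite s'E.
by rewrite mulfK // divff // ss' exprS => ->; rewrite mulr1.
Qed.

Section Rational.
Variables (F K : fieldType) (iota : {rmorphism F -> K}) (I : finType) (d : nat).
Implicit Types (N : submodClosed (tpow K I d)) (c : nat -> tpow F I d).

(** [N] is defined over F exactly when it is contained in [rat_span N]. *)
Definition rat_span N : {pred tpow K I d} :=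
  linspan (fun x => exists t, x = tpow_ext iota t /\ x \in N).

HB.instance Definition _ N := GRing.SubmodClosed.on (rat_span N).

Lemma rat_spanP N t : tpow_ext iota t \in N -> tpow_ext iota t \in rat_span N.
Proof. by move=> tN; apply: linspanP; exists t. Qed.

Lemma poly_values_rat N n c :
  (forall a : K, \sum_(k < n) a ^+ k *: tpow_ext iota (c k) \in N) ->
  forall a : K, \sum_(k < n) a ^+ k *: tpow_ext iota (c k) \in rat_span N.
Proof.
elim: n c => [|n IHn] c cN a; first by rewrite big_ord0 rpred0.
have [[s [us ns]]|ns] := pselect (exists s : seq K, uniq s /\ size s = n.+1).
  apply: rpred_sum => k _; apply: rpredZ; apply: rat_spanP.
  (* A form killing [N] turns the family into a polynomial of size at most [n.+1] with [n.+1] roots,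
     so it kills every coefficient. *)
  apply: double_annihilator => t tN.
  pose p := \poly_(k < n.+1) dot t (tpow_ext iota (c k)).
  have : p`_k = dot t (tpow_ext iota (c k)) by rewrite coef_poly ltn_ord.
  rewrite (@roots_geq_poly_eq0 _ p s) ?coef0 //; last by rewrite ns size_poly.
  apply/allP => b _; rewrite /root horner_poly; apply/eqP.
  rewrite -[RHS](tN _ (cN b)) [in RHS]linear_sum; apply: eq_bigr => i _.
  by rewrite linearZ mulrC.
(* Otherwise K is finite, and its order [q] is the largest length of a duplicate-free list. *)
pose h k := `[< exists s : seq K, uniq s /\ size s = k >].
have hb k : h k -> (k <= n)%N.
  case/asboolP=> s [us sk]; rewrite leqNgt; apply/negP => nk; apply: ns.
  by exists (take n.+1 s); rewrite take_uniq // size_takel // sk.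
have h2 : h 2 by apply/asboolP; exists [:: 0; 1];
  rewrite /= inE eq_sym oner_eq0.
case: (ex_maxnP (ex_intro (fun k => is_true (h k)) _ h2) hb) => q hq qmax.
have q2 := qmax _ h2; have qn := hb _ hq.
case/asboolP: hq => s [us sq].
have sK x : x \in s.
  apply: contraT => xs; have := qmax q.+1; rewrite ltnn; apply.
  by apply/asboolP; exists (x :: s); rewrite /= xs us sq.
have lt_n : ((n - q).+1 < n)%N by rewrite -[in ltnRHS](subnK qn) -addn2
  leq_add2l.
(* Since [b ^+ q = b], the power [b ^+ n] equals [b ^+ (n - q).+1]. Its coefficient moves to that
   exponent, which is below [n] because [2 <= q]; all coefficients stay over F. *)
pose c' k := c k + (if k == (n - q).+1 then c n else 0).
have cE b : \sum_(k < n.+1) b ^+ k *: tpow_ext iota (c k) =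
            \sum_(k < n) b ^+ k *: tpow_ext iota (c' k).
  have extD x y : tpow_ext iota (x + y) = tpow_ext iota x + tpow_ext iota y.
    by have := tpow_extP iota 1 x y; rewrite rmorph1 !scale1r.
  rewrite big_ord_recr /=; under [RHS]eq_bigr do rewrite extD scalerDr.
  rewrite big_split /=; congr (_ + _).
  rewrite (bigD1 (Ordinal lt_n)) //= eqxx big1 ?addr0 => [|i /negPf];
    last first.
    by rewrite -val_eqE /= => ->; rewrite tpow_ext0 scaler0.
  congr (_ *: _); rewrite -[in LHS](subnK qn) exprD -sq expf_size_enum //.
  by rewrite sq exprSr.
rewrite cE; apply: IHn => b; rewrite -cE; exact: cN.
Qed.
End Rational.

(** * Rationality of the coinvariant relations *)

Section SymRational.
Variables (F K : fieldType) (iota : {rmorphism F -> K}) (I : finType) (d : nat).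

Lemma tpow_op_poly (A : I -> I -> {poly F}) (y : tpow F I d) :
  exists n (c : nat -> tpow F I d), forall a : K,
    tpow_op (fun i j => (map_poly iota (A i j)).[a]) (tpow_ext iota y)
      - tpow_ext iota y = \sum_(k < n) a ^+ k *: tpow_ext iota (c k).
Proof.
pose q (w : {ffun 'I_d -> I}) : {poly F} :=
  \sum_(w' : {ffun 'I_d -> I}) (\prod_k A (w k) (w' k)) * (y w')%:P - (y w)%:P.
exists (\max_w size (q w)), (fun k => [ffun w => (q w)`_k]) => a.
apply/ffunP => w; transitivity (map_poly iota (q w)).[a].
  rewrite rmorphB rmorph_sum hornerD hornerN horner_sum !ffunE /= map_polyC
    hornerC.
  congr (_ - _); apply: eq_bigr => w' _; rewrite rmorphM hornerM /= map_polyC.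
  rewrite hornerC ffunE; congr (_ * _).
  by rewrite (rmorph_prod (map_poly iota)) horner_prod.
rewrite (@horner_coef_wide _ (\max_w size (q w))) ?size_map_poly; last first.
  exact: (leq_bigmax w).
rewrite sum_ffunE; apply: eq_bigr => k _.
by rewrite !ffunE coef_map mulrC.
Qed.

Let act (w : {ffun 'I_d -> I}) (s : 'S_d) : {ffun 'I_d -> I} := [ffun k =>
  w (s k)].

(** [pick] depends only on the predicate, so the choice is constant on orbits of the symmetric
    group. *)
Definition orbit_rep (w : {ffun 'I_d -> I}) : {ffun 'I_d -> I} :=
  odflt w [pick u | [exists s, u == act w s]].

Lemma orbit_repP w : exists s, orbit_rep w = act w s.
Proof.
rewrite /orbit_rep; case: pickP => [u /existsP[s /eqP->]|/(_ w)];
  first by exists s.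
by move/existsP; case; exists 1%g; apply/eqP/ffunP => k; rewrite ffunE perm1.
Qed.

Lemma orbit_rep_perm (w : {ffun 'I_d ->
  I}) (s : 'S_d) : orbit_rep [ffun k => w (s k)] = orbit_rep w.
Proof.
have PQ : (fun u => [exists t, u == act [ffun k => w (s k)] t]) =1
          (fun u => [exists t, u == act w t]).
  move=> u; apply/existsP/existsP => -[t /eqP->].
    by exists (t * s)%g; apply/eqP/ffunP => k; rewrite !ffunE permM.
  by exists (t * s^-1)%g; apply/eqP/ffunP => k; rewrite !ffunE permM permKV.
rewrite /orbit_rep (eq_pick PQ); case: pickP => //= /(_ w) /existsP; case.
by exists 1%g; apply/eqP/ffunP => k; rewrite ffunE perm1.
Qed.

Definition orbit_sum (E : fieldType) (u : {ffun 'I_d -> I}) : tpow E I d :=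
  [ffun w => (orbit_rep w == u)%:R].

Lemma orbit_sum_symT E u : orbit_sum E u \in @is_symT E I d.
Proof.
by apply/forallP => s; apply/eqP/ffunP => w; rewrite !ffunE orbit_rep_perm.
Qed.

(** Symmetric tensors have constant coordinates on orbits, so the orbit indicators, which are
    defined over F, span them. *)
Lemma symT_rational (y : tpow K I d) : y \in @is_symT K I d ->
  y = \sum_u y u *: tpow_ext iota (orbit_sum F u).
Proof.
move=> /forallP yS; apply/ffunP => w; rewrite sum_ffunE.
rewrite (bigD1 (orbit_rep w)) //= !ffunE eqxx rmorph1 big1 ?addr0.
  have [s ->] := orbit_repP w; have /eqP/ffunP/(_ w) := yS s.
  by rewrite ffunE /act => ->; rewrite [RHS]mulr1.
by move=> u uw; rewrite !ffunE eq_sym (negPf uw) rmorph0 [LHS]mulr0.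
Qed.
End SymRational.

Section CoinvRational.
Variables (F K : fieldType) (iota : {rmorphism F -> K}) (l d : nat).

(** The span I inside the whole tensor power, a coordinate space to which [dot] and [rat_span]
    apply. *)
Definition coinv_tpow : {pred tpow K (idx l) d} := fun x =>
  `[< exists2 n : symTrep K l d, n \in @coinv_rel K l d & val n = x >].

Fact coinv_tpow_submod_closed : submod_closed coinv_tpow.
Proof.
split=> [|a x y /asboolP[n nN <-] /asboolP[p pN <-]]; apply/asboolP.
  by exists 0; rewrite ?rpred0 ?linear0.
by exists (a *: n + p); rewrite ?rpredD ?rpredZ // linearP.
Qed.

HB.instance Definition _ := GRing.isSubmodClosed.Build K
  (tpow K (idx l) d) coinv_tpow coinv_tpow_submod_closed.

Lemma coinv_tpowE (n : symTrep K l d) : (val n \in coinv_tpow) =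
  (n \in @coinv_rel K l d).
Proof.
apply/asboolP/idP => [[p pN /val_inj <-] //|nN]; by exists n.
Qed.

Lemma coinv_tpow_gen (z : Zgroup l K) y : y \in @is_symT K (idx l) d ->
  tpow_op (Zmx z) y - y \in coinv_tpow.
Proof.
move=> yS; pose y' : symT K (idx l) d := Subspace yS.
apply/asboolP; exists (symT_op (Zmx z) y' - y') => //.
by apply: linspanP; exists z, y'.
Qed.

Lemma coinv_tpow_ind (S : submodClosed (tpow K (idx l) d)) :
  (forall (z : Zgroup l K) y, y \in @is_symT K (idx l) d ->
     tpow_op (Zmx z) y - y \in S) ->
  {subset coinv_tpow <= S}.
Proof.
move=> gS _ /asboolP[n nN <-].
apply: (@linspan_stable K (symT K (idx l) d) _ _ S val) nN.
by move=> _ [z [y ->]]; rewrite linearB; apply: gS; exact: valP.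
Qed.

Lemma coinv_tpow_rational : {subset coinv_tpow <= rat_span iota coinv_tpow}.
Proof.
have symT_op_sub (A B : 'M[K]_l) y : y \in @is_symT K (idx l) d ->
    tpow_op (mx3 A B 1%:M) y \in @is_symT K (idx l) d.
  exact: tpow_op_symT.
pose good (A B : 'M[K]_l) := forall y, y \in @is_symT K (idx l) d ->
  tpow_op (mx3 A B 1%:M) y - y \in rat_span iota coinv_tpow.
have good1 : good 1%:M 1%:M.
  by move=> y _; rewrite tpow_op1 ?subrr ?rpred0 // => i j; exact: mx3_1.
(* z z' y - y = (z (z' y) - z' y) + (z' y - y), where z' y is again symmetric. *)
have goodM A B A' B' : good A B -> good A' B' -> good (A *m A') (B *m B').
  move=> gA gA' y yS; rewrite (@tpow_opM _ _ _ (mx3 A B 1%:M) (mx3 A' B' 1%:M)).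
    by rewrite -(subrK (tpow_op (mx3 A' B' 1%:M) y) (tpow_op _ _)) -addrA
      rpredD ?gA ?gA' ?symT_op_sub.
  by move=> i j; rewrite -mx3_M mulmx1.
(* By linearity [y] may be an orbit sum, which is F-rational. Every value of the resulting
   polynomial family lies in I, so [poly_values_rat] applies. *)
have goodP (A : K -> 'M[K]_l * 'M[K]_l) (P : idx l -> idx l -> {poly F}) :
    (forall a, \det (A a).1 = 1 /\ \det (A a).2 = 1) ->
    (forall a i j, mx3 (A a).1 (A a).2 1%:M i j =
      (map_poly iota (P i j)).[a]) ->
    forall a, good (A a).1 (A a).2.
  move=> A1 AP a y yS; rewrite (symT_rational iota yS) linear_sum -sumrB.
  apply: rpred_sum => u _; rewrite linearZ -scalerBr; apply: rpredZ.
  have [n [c cE]] := @tpow_op_poly F K iota (idx l) d P (orbit_sum F u).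
  have opE b : tpow_op (mx3 (A b).1 (A b).2 1%:M) =1
      tpow_op (fun i j => (map_poly iota (P i j)).[b]) :> (tpow K (idx l) d ->
        _).
    move=> t; apply/ffunP => w; rewrite !ffunE; apply: eq_bigr => w' _.
    by congr (_ * _); apply: eq_bigr => k _; rewrite AP.
  rewrite [X in X - _]opE cE; apply: poly_values_rat => b; rewrite -cE -opE.
  have [/eqP A1b /eqP A2b] := A1 b.
  apply: (@coinv_tpow_gen (MkSL A1b, MkSL A2b)).
  rewrite -(_ : val (symT_ext iota (Subspace (orbit_sum_symT F u))) =
    tpow_ext iota (orbit_sum F u)) //.
  exact: valP.
have goodL A : \det A = 1 -> good A 1%:M.
  apply: (SL_elem_ind (P := fun A => good A 1%:M)) => // [A1 A2 g1 g2|i j a ij].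
    by rewrite -[1%:M]mulmx1; exact: goodM.
  pose E (b : K) := (elem_mx i j b, 1%:M : 'M[K]_l).
  pose P (p q : idx l) : {poly F} :=
    ((p.1.1 == q.1.1)%:R + 'X * ((p.1.1 == i) && (q.1.1 == j))%:R)
    * (p.1.2 == q.1.2)%:R * (p.2 == q.2)%:R.
  apply: (goodP E P _ _ a) => [b|b p q];
    first by rewrite /= det_elem_mx // det1.
  rewrite /mx3 !mxE !rmorphM rmorphD rmorphM /= !rmorph_nat map_polyX.
  by rewrite -!polyC_natr !hornerE.
have goodR B : \det B = 1 -> good 1%:M B.
  apply: (SL_elem_ind (P := fun B => good 1%:M B)) => // [B1 B2 g1 g2|i j b ij].
    by rewrite -[1%:M]mulmx1; exact: goodM.
  pose E (c : K) := (1%:M : 'M[K]_l, elem_mx i j c).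
  pose P (p q : idx l) : {poly F} := (p.1.1 == q.1.1)%:R
    * ((p.1.2 == q.1.2)%:R + 'X * ((p.1.2 == i) && (q.1.2 == j))%:R)
    * (p.2 == q.2)%:R.
  apply: (goodP E P _ _ b) => [c|c p q];
    first by rewrite /= det_elem_mx // det1.
  rewrite /mx3 !mxE !rmorphM rmorphD rmorphM /= !rmorph_nat map_polyX.
  by rewrite -!polyC_natr !hornerE.
apply: coinv_tpow_ind => z y yS.
have -> : Zmx z = mx3 (z.1 *m 1%:M) (1%:M *m z.2) 1%:M by rewrite mulmx1 mul1mx.
by apply: goodM yS; [apply: goodL | apply: goodR]; exact: det_SL.
Qed.
End CoinvRational.

(** * The duality between invariants and coinvariants *)

Section SymDuality.
Variables (F : fieldType) (I : finType) (d : nat).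
Implicit Types (t x : tpow F I d).

Lemma dot_perm s t x : dot (tpow_perm s t) x = dot t (tpow_perm s^-1%g x).
Proof.
pose h (w : {ffun 'I_d -> I}) : {ffun 'I_d -> I} := [ffun k => w (s^-1%g k)].
have hI : injective h.
  move=> w1 w2 /ffunP e; apply/ffunP => k.
  by have := e (s k); rewrite !ffunE permK.
rewrite /dot (reindex_inj hI); apply: eq_bigr => w _; rewrite !ffunE;
  congr (t _ * _).
by apply/ffunP => k; rewrite !ffunE permK.
Qed.

(** A permutation is adjoint to its inverse; conversely, pairing with basis vectors recovers the
    coordinates of [t]. *)
Lemma symT_annihilator t :
  (t \in @is_symT F I d) <-> {in @is_sym_rel F I d, forall x, dot t x = 0}.
Proof.
split=> [/forallP tS _ /asboolP[n [c [u [uP ->]]]]|tS].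
  rewrite linear_sum big1 // => i _; have [s [y ->]] := uP i.
  have /eqP tsE := tS s^-1%g.
  by rewrite linearZ linearB /= -[s]invgK -dot_perm tsE subrr scaler0.
apply/forallP => s; apply/eqP/ffunP => w; rewrite -!dot_basis; apply/eqP.
rewrite dot_perm -subr_eq0 -linearB; apply/eqP/tS/linspanP.
by exists s^-1%g, (basis_ffun F w).
Qed.

Lemma sym_rel_annihilator x :
  (x \in @is_sym_rel F I d) <-> {in @is_symT F I d, forall t, dot t x = 0}.
Proof.
split=> [xR t /symT_annihilator -> //|xS].
by apply: double_annihilator => t tR; apply/xS/symT_annihilator => y /tR.
Qed.

Lemma dot_symT_proj (v : symT F I d) t :
  dot (val v) (generic_quotient.repr (proj (@is_sym_rel F I d) t)) =
    dot (val v) t.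
Proof.
apply/eqP; rewrite -subr_eq0 -linearB; apply/eqP.
by apply: (iffLR (symT_annihilator _) (valP v)); exact: proj_reprB.
Qed.

Lemma tpow_op_tr A t x :
  dot (tpow_op A t) x = dot t (tpow_op (fun i j => A j i) x).
Proof. exact: dot_opmx. Qed.
End SymDuality.

Section Pairing.
Variables (F K : fieldType) (iota : {rmorphism F -> K}) (l d : nat).
Local Notation J := (idx l).
Local Notation pr := (proj (@is_sym_rel F (idx l) d)).
Local Notation N := (@coinv_tpow K l d).

Lemma dot_ext (t x : tpow F J d) :
  dot (tpow_ext iota t) (tpow_ext iota x) = iota (dot t x).
Proof.
by rewrite /dot rmorph_sum; apply: eq_bigr => w _; rewrite !ffunE rmorphM.
Qed.

Definition tr_SL n (E : fieldType) (g : SL n E) : SL n E :=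
  MkSL (eq_ind_r (fun a => a == 1) (valP g : \det g == 1) (det_tr g)).

(** <z y - y, t> = <y, z^T t - t>; this vanishes for all symmetric y iff z^T fixes the class of t,
    and transposition maps Z onto itself. *)
Lemma inv_annihilator (t : tpow F J d) :
  (pr t \in @is_inv F K iota l d) <->
    {in N, forall n, dot n (tpow_ext iota t) = 0}.
Proof.
have Ztr (z : Zgroup l K) : (fun i j => Zmx z j i) = Zmx (tr_SL z.1, tr_SL z.2).
  apply/funext => i; apply/funext => j.
  by rewrite /Zmx /mx3 !mxE [i.2 == _]eq_sym.
have dotZ z y : dot (tpow_op (Zmx z) y - y) (tpow_ext iota t) =
    dot y (tpow_op (Zmx (tr_SL z.1, tr_SL z.2)) (tpow_ext iota t) - tpow_ext
      iota t).
  by rewrite dotC linearB /= ![dot (tpow_ext _ _) _]dotC tpow_op_tr Ztr linearB.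
have trK z : (tr_SL (tr_SL z.1), tr_SL (tr_SL z.2)) = z :> Zgroup l K.
  by case: z => z1 z2; congr pair; apply: val_inj; rewrite /= trmxK.
split=> [/asboolP tI n nN|tN].
  apply/eqP; rewrite -[_ == 0]/(n \in dot_orth (tpow_ext iota t)).
  apply: coinv_tpow_ind nN.
  move=> z y yS; apply/eqP; rewrite dotZ;
    apply: (iffLR (sym_rel_annihilator _)) yS.
  by rewrite -proj_eq -symP_opE -symP_extE tI.
apply/asboolP => z; rewrite symP_extE symP_opE; apply: proj_eqP.
apply/sym_rel_annihilator => y yS.
by have := tN _ (coinv_tpow_gen (tr_SL z.1, tr_SL z.2) yS); rewrite dotZ trK.
Qed.

Definition coinv_pre : {pred tpow F J d} := fun t => tpow_ext iota t \in N.

Fact coinv_pre_submod_closed : submod_closed coinv_pre.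
Proof.
split=> [|a x y xN yN];
  first by rewrite -topredE /= /coinv_pre tpow_ext0 rpred0.
by rewrite -topredE /= /coinv_pre tpow_extP rpredD ?rpredZ.
Qed.

HB.instance Definition _ := GRing.isSubmodClosed.Build F (tpow F J d)
  coinv_pre coinv_pre_submod_closed.

Lemma coinv_annihilator (v : symT F J d) :
  (symT_ext iota v \in @coinv_rel K l d) <->
  (forall t, pr t \in @is_inv F K iota l d -> dot (val v) t = 0).
Proof.
rewrite -coinv_tpowE; split=> [vN t /inv_annihilator tN|vt].
  by apply/eqP; rewrite -(fmorph_eq0 iota) -dot_ext; apply/eqP/tN.
suff : val v \in coinv_pre by [].
apply: double_annihilator => t tN; rewrite dotC; apply: vt;
  apply/inv_annihilator.
(* The tensor [t] is orthogonal to the F-rational vectors of I, hence to their K-span, which is all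
   of I. *)
move=> n /coinv_tpow_rational-/(_ F iota) nR; apply/eqP.
apply: (@linspan_stable _ _ _ _ (dot_orth (tpow_ext iota t)) idfun) nR.
move=> _ [s [-> sN]]; apply/eqP; rewrite dot_ext dotC tN ?rmorph0 //.
Qed.

Definition inv_pre : {pred tpow F J d} := fun t =>
  pr t \in @is_inv F K iota l d.

Fact inv_pre_submod_closed : submod_closed inv_pre.
Proof.
split=> [|a x y xI yI]; rewrite -topredE /= /inv_pre ?linear0 ?rpred0 //.
by rewrite linearP rpredD ?rpredZ.
Qed.

HB.instance Definition _ := GRing.isSubmodClosed.Build F (tpow F J d)
  inv_pre inv_pre_submod_closed.

(** Pull the form back to [inv_pre] and extend it to a dot product. The relations have class 0, so
    the representing tensor kills them and is symmetric. *)
Lemma dual_representative (phi : dualrep (invariants iota l d)) :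
  exists v : symT F J d, forall (x : invariants iota l d) t,
    val x = pr t -> val phi x = dot (val v) t.
Proof.
have /asboolP phi_lin := valP phi.
(* Outside [inv_pre] the value is the default 0; linearity is needed only on [inv_pre]. *)
pose lift (t : tpow F J d) : invariants iota l d := insubd 0 (pr t).
have liftE t : t \in inv_pre -> val (lift t) = pr t by move=> tI;
  rewrite insubdK.
have phi0 : val phi 0 = 0.
  by have := phi_lin (-1) 0 0; rewrite scaler0 addr0 scaleN1r addNr.
have [a x y xI yI|t0 t0P] := @extend_form _ _ inv_pre (fun t =>
  val phi (lift t)).
  rewrite -phi_lin; congr (val phi _); apply: val_inj.
  by rewrite linearP liftE ?rpredD ?rpredZ // linearP /= !liftE.
have t0S : t0 \in @is_symT F J d.
  apply/symT_annihilator => x xR.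
  have x0 : pr x = 0 by rewrite -(linear0 pr); apply: proj_eqP; rewrite subr0.
  have xI : x \in inv_pre by rewrite -topredE /= /inv_pre x0 rpred0.
  rewrite -t0P // -[RHS]phi0; congr (val phi _); apply: val_inj.
  by rewrite liftE // x0.
exists (Subspace t0S) => x t xt /=.
have tI : t \in inv_pre by rewrite -topredE /= /inv_pre -xt; exact: valP.
by rewrite -t0P //; congr (val phi _); apply: val_inj; rewrite liftE.
Qed.

Fact coinv_class_subproof (v : symT F J d) :
  proj (@coinv_rel K l d) (symT_ext iota v) \in @is_coinv F K iota l d.
Proof. by apply/asboolP; exists v. Qed.

Definition coinv_class (v : symT F J d) : coinvariants iota l d :=
  Subspace (coinv_class_subproof v).

Fact coinv_class_is_linear : linear coinv_class.
Proof. by move=> a v w; apply: val_inj; rewrite /= symT_extP linearP. Qed.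

HB.instance Definition _ := GRing.isLinear.Build F (symT F J d)
  (coinvariants iota l d) _ coinv_class coinv_class_is_linear.

Lemma coinv_class_surj x : exists v, x = coinv_class v.
Proof. by have /asboolP[v vx] := valP x; exists v; apply: val_inj. Qed.

Lemma coinv_class_act g v :
  rep_act g (coinv_class v) = coinv_class (symT_op (SL2mx g) v).
Proof.
apply: val_inj; rewrite /= (symT_ext_op _ (SL2mx_map iota g)).
exact: (quotrep_actE (@coinv_rel_stable K l d) (map_SL iota g)).
Qed.

(** This gives both that the class of a representing tensor depends only on the form and that it
    determines the form. *)
Lemma coinv_class_eq v w : coinv_class v = coinv_class w <->
  (forall t, t \in inv_pre -> dot (val v) t = dot (val w) t).
Proof.
have e : (coinv_class v == coinv_class w) =
    (symT_ext iota (v - w) \in @coinv_rel K l d).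
  rewrite addrC -scaleN1r symT_extP rmorphN1 scaleN1r addrC.
  exact: (proj_eq (@coinv_rel K l d)).
have dotB t : dot (val (v - w)) t = dot (val v) t - dot (val w) t.
  by rewrite dotC !linearB /= ![dot t _]dotC.
split=> [/eqP|vw]; last apply/eqP; rewrite e.
  by move=> /coinv_annihilator vw t /vw/eqP; rewrite dotB subr_eq0 => /eqP.
by apply/coinv_annihilator => t tI; rewrite dotB vw // subrr.
Qed.
End Pairing.

(** * The Weyl element and inverse transposes in SL_2 *)

Section Weyl.
Variable F : fieldType.

Lemma sum_ord2 (f : 'I_2 -> F) : \sum_i f i = f 0 + f 1.
Proof. by rewrite big_ord_recl big_ord1; congr (_ + f _); apply: val_inj. Qed.

Lemma det_mx22 (A : 'M[F]_2) : \det A = A 0 0 * A 1 1 - A 0 1 * A 1 0.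
Proof.
rewrite (expand_det_row _ 0) sum_ord2 /cofactor !det_mx11 !mxE /=.
rewrite expr0 expr1 mul1r mulN1r mulrN.
by congr (_ * A _ _ - _ * A _ _); apply: val_inj.
Qed.

(** The matrix with rows (0, 1) and (-1, 0). *)
Definition weyl_mx : 'M[F]_2 :=
  \matrix_(i, j) ((i < j)%N%:R - (j < i)%N%:R).

Fact det_weyl : \det weyl_mx == 1.
Proof. by rewrite det_mx22 !mxE /= !subrr sub0r subr0 mul0r mul1r sub0r opprK.
  Qed.

Definition weyl : SL 2 F := MkSL det_weyl.

(* For a 2 x 2 matrix, g W g^T = det(g) W. *)
Lemma weyl_tr (g : SL 2 F) : (weyl * tr_SL g^-1 = g * weyl)%g.
Proof.
apply: (mulIg (tr_SL g)); rewrite -mulgA.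
have -> : (tr_SL g^-1 * tr_SL g = 1)%g.
  by apply: val_inj; rewrite /= -trmx_mul mulmxV ?trmx1 ?unitmx_SL.
rewrite mulg1; apply: val_inj; apply/matrixP => i j.
have := det_SL g; rewrite det_mx22 !mxE !sum_ord2 !mxE !sum_ord2 !mxE /= => dg.
have ord2 (k : 'I_2) : k = 0 \/ k = 1.
  by case: k => [[|[|[]]]] // ?; [left|right]; apply: val_inj.
pose simp := (subrr, subr0, sub0r, mulr0, mulr1, mulrN1, mulNr, addr0, add0r).
case: (ord2 i) => ->; case: (ord2 j) => -> /=; rewrite !simp.
- by rewrite mulrC addNr.
- by rewrite -dg addrC.
- by rewrite -dg opprB addrC [g 1 1 * _]mulrC [g 1 0 * _]mulrC.
- by rewrite mulrC addNr.
Qed.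
End Weyl.

(** * The equivariant isomorphism *)

Lemma bijective_of_inj_surj (T U : Type) (f : T -> U) :
  injective f -> (forall y, exists x, y = f x) -> bijective f.
Proof.
move=> fI fS; pose g y := projT1 (cid (fS y)).
have gK y : f (g y) = y by rewrite /g; case: cid.
by exists g => // x; apply: fI; rewrite gK.
Qed.

Theorem mainTheorem7 (F K : fieldType) (iota : {rmorphism F -> K})
    (l m : nat) (hl : (0 < l)%N) (hm : (0 < m)%N) :
  rep_iso (dualrep (invariants iota l (l * m)%N))
          (coinvariants iota l (l * m)%N).
Proof.
move: (l * m)%N => d {hl hm m}.
pose D := dualrep (invariants iota l d); pose C := coinvariants iota l d.
pose r (phi : D) := projT1 (cid (dual_representative phi)).
have rP (phi : D) (x : invariants iota l d) t :
    val x = proj (@is_sym_rel F (idx l) d) t -> val phi x = dot (val (r phi)) t.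
  by rewrite /r; case: cid => v vP /=; exact: vP.
pose W : C -> C := rep_act (weyl F).
have WI : injective W.
  by apply: (can_inj (g := rep_act (weyl F)^-1%g)) => x;
    rewrite /W -rep_actM mulVg rep_act1.
pose f (phi : D) : C := W (coinv_class iota (r phi)).
(* The chosen [r] need not be linear or equivariant, but any representing tensor computes [f phi];
   linearity and equivariance follow from suitable choices. *)
have classP (phi : D) (v : symT F (idx l) d) :
    (forall x t, val x = proj (@is_sym_rel F (idx l) d) t -> val phi x =
      dot (val v) t) ->
    f phi = W (coinv_class iota v).
  move=> vP; congr W; apply/coinv_class_eq => t tI.
  pose x : invariants iota l d := @Subspace F (symPrep F l d) (@is_inv F K iota
    l d) _ tI.
  by rewrite -(rP _ x) // (vP x t).
have fl : linear f.
  move=> a phi psi; rewrite (classP _ (a *: r phi + r psi)) => [|x t xt].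
    by rewrite /f /W !linearP.
  by rewrite dotC !linearP /= ![dot t _]dotC -!(rP _ x t xt).
pose fL : {linear D -> C} := HB.pack f (GRing.isLinear.Build _ _ _ _ f fl).
exists fL; split.
  apply: bijective_of_inj_surj => [phi psi /WI/coinv_class_eq e|y].
    apply: val_inj; apply/funext => x.
    have xE := esym (proj_repr (val x)).
    rewrite !(rP _ x _ xE); apply: e.
    rewrite -topredE /= /inv_pre proj_repr; exact: valP.
  have [v vE] := coinv_class_surj (rep_act (weyl F)^-1%g y).
  (* The preimage of [y] is the pairing with [v], whose class is the inverse Weyl translate of
     [y]. *)
  pose phi0 (x : invariants iota l d) : F^o := dot (val v) (repr (val x)).
  have phi0l : phi0 \in @is_form F (SL 2 F) (invariants iota l d).
    apply/asboolP => a x z; rewrite /phi0 -linearP -[RHS]dot_symT_proj.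
    by rewrite linearP /= linearP /= !proj_repr.
  exists (Subspace phi0l); rewrite -[LHS]rep_act1 -(mulgV (weyl F)) rep_actM vE.
  by rewrite [RHS](classP _ v) // => x t xt; rewrite /= /phi0 xt dot_symT_proj.
move=> g phi.
(* The form g phi evaluates phi at g^-1 x, so by adjunction g^-T applied to [r phi] represents
   it. *)
rewrite -[fL _]/(f _) -[fL phi]/(f _) (classP _ (symT_op (SL2mx (tr_SL g^-1%g))
  (r phi))).
  by rewrite -coinv_class_act /W /f -!rep_actM weyl_tr.
move=> x t xt /=.
rewrite (rP _ _ (tpow_op (SL2mx g^-1%g) t)).
  rewrite tpow_op_tr; congr dot; congr (tpow_op _ t).
  apply/funext => i; apply/funext => j; rewrite /SL2mx /mx3 !mxE.
  by rewrite [j.1.1 == _]eq_sym [j.1.2 == _]eq_sym.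
by rewrite /= xt -symP_opE.
Qed.
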